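(* The discrete Heisenberg group $\mathsf{H}_3(\mathbb{Z})$ admits a non-empty strongly aperiodic shift of finite type $\Omega$ together with a factor map $\phi:\Omega\to\phi(\Omega)$ onto a subshift $\phi(\Omega)$ (over some finite alphabet) such that: (i) $\phi(\Omega)$ is strongly aperiodic and minimal (and hence is a strongly aperiodic, minimal sofic $\mathsf{H}_3(\mathbb{Z})$-shift); (ii) $\phi$ is at most two-to-one, i.e. every configuration in $\phi(\Omega)$ has at most two preimages under $\phi$; (iii) $\phi$ is one-to-one on a dense set of configurations, i.e. there is a dense subset $D\subseteq\phi(\Omega)$ such that every $\omega\in D$ has exactly one preimage.
   Context: The discrete Heisenberg group $\mathsf{H}_3(\mathbb{Z})$ is the group of $3\times 3$ upper-triangular unipotent integer matrices $\begin{pmatrix}1&x&z\\0&1&y\\0&0&1\end{pmatrix}$, $x,y,z\in\mathbb{Z}$, under matrix multiplication; equivalently the semidirect product $\mathbb{Z}^2\rtimes_A\mathbb{Z}$ with $A=\begin{pmatrix}1&0\\1&1\end{pmatrix}$, with operation $(x,(y,z))\cdot(a,(b,c))=(x+a,(y+b,z+c+xb))$. For a finitely generated group $G$ and finite alphabet $\mathcal{A}$, the full shift is $\mathcal{A}^G$ with the prodiscrete (product) topology and the right shift action $(\sigma^g\omega)_h=\omega_{hg}$. A subshift is a non-empty closed shift-invariant subset $\Omega\subseteq\mathcal{A}^G$. A pattern is a map $p:F\to\mathcal{A}$ with $F\subseteq G$ finite; $p$ occurs in $\omega$ if $\omega|_{Fg}$ equals $p$ translated, for some $g\in G$. A shift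 of finite type (SFT) is a set of the form $\{\omega\in\mathcal{A}^G: \text{no } p\in\mathcal{F}\text{ occurs in }\omega\}$ for a finite set $\mathcal{F}$ of patterns. A factor map between subshifts is a continuous surjective map commuting with the shift actions; a sofic shift is a factor of an SFT. The stabilizer of $\omega$ is $\mathrm{Stab}(\omega)=\{g\in G:\sigma^g\omega=\omega\}$; a subshift is strongly aperiodic if every configuration in it has trivial stabilizer. A subshift is minimal if it contains no non-empty proper closed shift-invariant subset (equivalently, every orbit is dense). *)

(* Defs.v *)
From Stdlib Require Import ZArith List.
From mathcomp Require Import ssreflect ssrfun ssrbool eqtype fintype.
Set Implicit Arguments.
Unset Strict Implicit.
Unset Printing Implicit Defensive.
Import ListNotations.
Open Scope Z_scope.

(** The discrete Heisenberg group H_3(Z): the triple (x, y, z) stands for the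
    matrix [[1,x,z],[0,1,y],[0,0,1]]; the product is matrix multiplication,
    i.e. (x,(y,z)).(a,(b,c)) = (x+a,(y+b, z+c+x*b)). *)
Definition H3 : Type := (Z * Z * Z)%type.
Definition h3_mul (g h : H3) : H3 :=
  let '(x, y, z) := g in let '(a, b, c) := h in
  (x + a, y + b, z + c + x * b).
Definition h3_one : H3 := (0, 0, 0).

Definition config (A : Type) := H3 -> A.
Definition shift {A : Type} (g : H3) (w : config A) : config A :=
  fun h => w (h3_mul h g).

Definition cfg_eq {A : Type} (w w' : config A) : Prop := forall h, w h = w' h.

Definition agree_on {A : Type} (F : list H3) (w w' : config A) : Prop :=
  forall h, In h F -> w h = w' h.

Definition cset (A : Type) := config A -> Prop.

(** Closed in the prodiscrete topology: contains every configuration all of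
    whose finite windows are approximated by elements of the set. *)
Definition closed_set {A : Type} (X : cset A) : Prop :=
  forall w, (forall F : list H3, exists w', X w' /\ agree_on F w w') -> X w.

Definition shift_invariant {A : Type} (X : cset A) : Prop :=
  forall g w, X w -> X (shift g w).

Definition nonempty {A : Type} (X : cset A) : Prop := exists w, X w.

Definition subshift {A : Type} (X : cset A) : Prop :=
  nonempty X /\ closed_set X /\ shift_invariant X.

Definition dense_in {A : Type} (D X : cset A) : Prop :=
  (forall w, D w -> X w) /\
  forall w F, X w -> exists d, D d /\ agree_on F w d.

(** Patterns: finite partial maps H3 -> A given as lists of (position, letter).
    p occurs in w at g when w (h g) = p(h) for all h in the support. *)
Definition pattern (A : Type) := list (H3 * A).
Definition occurs_at {A : Type} (p : pattern A) (w : config A) (g : H3) : Prop :=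
  forall h a, In (h, a) p -> w (h3_mul h g) = a.
Definition occurs {A : Type} (p : pattern A) (w : config A) : Prop :=
  exists g, occurs_at p w g.

Definition SFT_of {A : Type} (Fb : list (pattern A)) : cset A :=
  fun w => forall p, In p Fb -> ~ occurs p w.
Definition is_SFT {A : Type} (X : cset A) : Prop :=
  exists Fb : list (pattern A), forall w, X w <-> SFT_of Fb w.

Definition strongly_aperiodic {A : Type} (X : cset A) : Prop :=
  forall w g, X w -> cfg_eq (shift g w) w -> g = h3_one.

Definition minimal {A : Type} (X : cset A) : Prop :=
  forall Y : cset A, (forall w, Y w -> X w) -> nonempty Y -> closed_set Y ->
    shift_invariant Y -> forall w, X w -> Y w.

Definition img_set {A B : Type} (phi : config A -> config B) (X : cset A) : cset B :=
  fun y => exists w, X w /\ cfg_eq (phi w) y.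

Definition continuous_on {A B : Type} (phi : config A -> config B) (X : cset A)
  : Prop :=
  forall w (F : list H3), X w -> exists E : list H3,
    forall w', X w' -> agree_on E w w' -> agree_on F (phi w) (phi w').

Definition equivariant_on {A B : Type} (phi : config A -> config B) (X : cset A)
  : Prop :=
  forall g w, X w -> cfg_eq (phi (shift g w)) (shift g (phi w)).

(** phi is a factor map from X onto its image: continuous and shift-commuting
    on X, and (as a map into phi(X)) automatically surjective. *)
Definition factor_map_on {A B : Type} (phi : config A -> config B) (X : cset A)
  : Prop := continuous_on phi X /\ equivariant_on phi X.

Definition at_most_two_to_one {A B : Type} (phi : config A -> config B)
  (X : cset A) : Prop :=
  forall y w1 w2 w3, X w1 -> X w2 -> X w3 ->
    cfg_eq (phi w1) y -> cfg_eq (phi w2) y -> cfg_eq (phi w3) y ->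
    cfg_eq w1 w2 \/ cfg_eq w1 w3 \/ cfg_eq w2 w3.

Definition unique_preimage {A B : Type} (phi : config A -> config B)
  (X : cset A) (y : config B) : Prop :=
  exists w, X w /\ cfg_eq (phi w) y /\
    forall w', X w' -> cfg_eq (phi w') y -> cfg_eq w' w.

(* Main.v *)
From mathcomp Require Import ssreflect ssrfun ssrbool eqtype ssrnat seq fintype.
From Stdlib Require Import ZArith Lia ZifyClasses List Classical.
From Stdlib Require Import FunctionalExtensionality PropExtensionality.
Require Import Defs.
Set Implicit Arguments.
Unset Strict Implicit.
Unset Printing Implicit Defensive.
Open Scope Z_scope.

(** There is a strongly aperiodic shift of finite type that is itself minimal, so the
    factor map can be the identity.  Give the plane [x = const] (a coset of <Y, Z>)
    the level v_2(x) and the plane [y = const] (a coset of <X, Z>) the level v_2(y).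
    A plane of level [l] carries clocks that display the other horizontal coordinate
    in units of [2^l] and the central coordinate in units of [4^l]; local rules make
    the clocks constant or advancing along the plane, and at the Z-line where two
    planes cross the two sets of clocks are compared.  The comparison makes the clocks
    of the odd planes read coordinates modulo 4, and the even planes satisfy the same
    rules after rescaling by the endomorphism (x, y, z) -> (2x, 2y, 4z).  So every
    configuration desubstitutes into another one.  A period is divisible by this
    endomorphism infinitely often, hence trivial.  A single tile of the k-fold
    desubstitution determines the configuration on a ball of radius about 2^k, and
    every admissible tile occurs in every configuration: this gives minimality. *)

Ltac Zify.zify_post_hook ::= Z.to_euclidean_division_equations.

#[local] Arguments Z.add : simpl never.
#[local] Arguments Z.sub : simpl never.
#[local] Arguments Z.mul : simpl never.
#[local] Arguments Z.div : simpl never.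
#[local] Arguments Z.modulo : simpl never.

(** * The Heisenberg group and its configurations *)

Definition h3_inv (g : H3) : H3 := let '(x, y, z) := g in (- x, - y, x * y - z).

Lemma h3_mulE x y z a b c : h3_mul (x, y, z) (a, b, c) = (x + a, y + b, z + c + x * b).
Proof. by []. Qed.

Ltac h3_eq := rewrite ?h3_mulE; congr (_, _, _); lia.

Lemma h3_mulA g h k : h3_mul g (h3_mul h k) = h3_mul (h3_mul g h) k.
Proof. by case: g h k => [[? ?] ?] [[? ?] ?] [[? ?] ?]; h3_eq. Qed.

Lemma h3_mul1 g : h3_mul g h3_one = g.
Proof. by case: g => [[? ?] ?]; rewrite /h3_one; h3_eq. Qed.

Lemma h3_1mul g : h3_mul h3_one g = g.
Proof. by case: g => [[? ?] ?]; rewrite /h3_one; h3_eq. Qed.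

Lemma h3_mulVl g : h3_mul (h3_inv g) g = h3_one.
Proof. by case: g => [[? ?] ?]; rewrite /h3_one /h3_inv; h3_eq. Qed.

Lemma h3_conjE i j k a b c :
  h3_mul (h3_mul (i, j, k) (a, b, c)) (h3_inv (i, j, k)) = (a, b, c + i * b - a * j).
Proof. by rewrite /h3_inv; h3_eq. Qed.

Lemma cfg_eqP (A : Type) (w w' : config A) : cfg_eq w w' -> w = w'.
Proof. exact: functional_extensionality. Qed.

Lemma shift_mul (A : Type) (w : config A) g h : shift g (shift h w) = shift (h3_mul g h) w.
Proof. by apply: functional_extensionality => k; rewrite /shift h3_mulA. Qed.

Lemma period_conj (A : Type) (w : config A) g p : cfg_eq (shift p w) w ->
  cfg_eq (shift (h3_mul (h3_mul g p) (h3_inv g)) (shift g w)) (shift g w).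
Proof.
by move=> /cfg_eqP period h; rewrite shift_mul -h3_mulA h3_mulVl h3_mul1 -shift_mul period.
Qed.

(** * Shifts of finite type *)

Lemma SFT_closed (A : Type) (X : cset A) : is_SFT X -> closed_set X.
Proof.
move=> [Fb XE] w approx; apply/XE => p Fb_p [g occ].
have [w' [/XE Xw' agr]] := approx (map (fun ha => h3_mul ha.1 g) p).
apply: (Xw' p Fb_p); exists g => h a p_ha.
by rewrite -agr; [apply: occ|apply: (in_map (fun ha => h3_mul ha.1 g) p (h, a))].
Qed.

Lemma SFT_shift_invariant (A : Type) (X : cset A) : is_SFT X -> shift_invariant X.
Proof.
move=> [Fb XE] g w /XE Xw; apply/XE => p Fb_p [h occ]; apply: (Xw p Fb_p).
by exists (h3_mul h g) => k a /occ; rewrite /shift h3_mulA.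
Qed.

Lemma is_SFT_and (A : Type) (X Y : cset A) :
  is_SFT X -> is_SFT Y -> is_SFT (fun w => X w /\ Y w).
Proof.
move=> [FX XE] [FY YE]; exists (FX ++ FY)%list => w; split.
  by move=> [/XE Xw /YE Yw] p /in_app_iff [/Xw|/Yw].
by move=> XYw; split; [apply/XE|apply/YE] => p Fp; apply: XYw; apply/in_app_iff; [left|right].
Qed.

Lemma exists_filter (T : Type) (P : T -> Prop) (l : list T) :
  exists l', forall x, In x l' <-> In x l /\ P x.
Proof.
elim: l => [|a l [l' l'E]]; first by exists nil => x /=; tauto.
have [Pa|Pa] := classic (P a).
- exists (a :: l') => x; rewrite /= l'E; split; last tauto.
  by case=> [<-|]; tauto.
- exists l' => x; rewrite l'E /=; split; first tauto.
  by case=> [[<-|?] ?]; tauto.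
Qed.

Lemma In_enum (T : finType) (x : T) : In x (enum T).
Proof.
have : x \in enum T by rewrite mem_enum.
by elim: (enum T) => [|a l IH] //; rewrite seq.in_cons => /orP[/eqP ->|/IH]; [left|right].
Qed.

Lemma pair_rule_SFT (T : finType) (R : T -> T -> Prop) (s : H3) :
  is_SFT (fun w : config T => forall g, R (w g) (w (h3_mul s g))).
Proof.
have [l lE] := exists_filter (fun p : T * T => ~ R p.1 p.2) (list_prod (enum T) (enum T)).
exists (List.map (fun p => [:: (h3_one, p.1); (s, p.2)]) l) => w; split=> [Rw p|Rw g].
- move=> /in_map_iff [[a b] [<- /lE [_ forbidden]]] [g occ]; apply: forbidden => /=.
  rewrite -(occ s b) /=; last by right; left.
  rewrite -[X in R X](occ h3_one a); last by left.
  by rewrite h3_1mul.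
- apply: NNPP => forbidden.
  apply: (Rw [:: (h3_one, w g); (s, w (h3_mul s g))]).
    apply/in_map_iff; exists (w g, w (h3_mul s g)); split=> //.
    by apply/lE; split=> //; apply/in_prod_iff; split; apply: In_enum.
  by exists g => h a [[<- <-]|[[<- <-]|[]]] //; rewrite h3_1mul.
Qed.

Lemma recurrent_minimal (A : Type) (X : cset A) :
  (forall w w' F, X w -> X w' -> exists g, agree_on F w (shift g w')) -> minimal X.
Proof.
move=> rec Y YX [w' Yw'] Ycl Yinv w Xw; apply: Ycl => F.
have [g agr] := rec w w' F Xw (YX _ Yw').
by exists (shift g w'); split=> //; apply: Yinv.
Qed.

Lemma img_set_id (A : Type) (X : cset A) : img_set id X = X.
Proof.
apply: functional_extensionality => y; apply: propositional_extensionality.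
by split=> [[w [Xw /cfg_eqP <-]]|Xy] //; exists y.
Qed.

(** * Residues *)

Definition Z_of_ord (m : nat) (i : 'I_m) : Z := Z.of_nat i.
Coercion Z_of_ord : ordinal >-> Z.

Definition residue (m : nat) (n : Z) : 'I_m.+1 := inord (Z.to_nat (n mod Z.of_nat m.+1)).

Lemma Z_of_ord_bounds m (i : 'I_m) : 0 <= i < Z.of_nat m.
Proof. rewrite /Z_of_ord; case: i => i /= /ssrnat.ltP; lia. Qed.

Lemma Z_of_ord_inj m (i j : 'I_m) : i = j <-> i = j :> Z.
Proof. by split=> [->|E] //; exact/ord_inj/Nat2Z.inj. Qed.

Lemma residueK m n : residue m n = n mod Z.of_nat m.+1 :> Z.
Proof. by rewrite /Z_of_ord /residue inordK; [|apply/ssrnat.ltP]; lia. Qed.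

Notation bit := 'I_2.
Notation quarter := 'I_4.
Notation bit_of := (residue 1).
Notation quarter_of := (residue 3).

#[local] Instance Inj_bit : InjTyp bit Z :=
  { inj b := b : Z; pred n := 0 <= n < 2;
    cstr := @Z_of_ord_bounds 2 : forall i, 0 <= Z_of_ord i < 2 }.
Add Zify InjTyp Inj_bit.
#[local] Instance Op_eq_bit : BinRel (@eq bit) := { TR := @eq Z; TRInj := @Z_of_ord_inj 2 }.
Add Zify BinRel Op_eq_bit.
#[local] Instance Op_Z_of_bit : UnOp (@Z_of_ord 2) := { TUOp n := n; TUOpInj b := erefl }.
Add Zify UnOp Op_Z_of_bit.
#[local] Instance Op_bit_of : UnOp bit_of := { TUOp n := n mod 2; TUOpInj := @residueK 1 }.
Add Zify UnOp Op_bit_of.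

#[local] Instance Inj_quarter : InjTyp quarter Z :=
  { inj q := q : Z; pred n := 0 <= n < 4;
    cstr := @Z_of_ord_bounds 4 : forall i, 0 <= Z_of_ord i < 4 }.
Add Zify InjTyp Inj_quarter.
#[local] Instance Op_eq_quarter : BinRel (@eq quarter) :=
  { TR := @eq Z; TRInj := @Z_of_ord_inj 4 }.
Add Zify BinRel Op_eq_quarter.
#[local] Instance Op_Z_of_quarter : UnOp (@Z_of_ord 4) := { TUOp n := n; TUOpInj q := erefl }.
Add Zify UnOp Op_Z_of_quarter.
#[local] Instance Op_quarter_of : UnOp quarter_of :=
  { TUOp n := n mod 4; TUOpInj := @residueK 3 }.
Add Zify UnOp Op_quarter_of.

Lemma exists_nat_ge z : exists n : nat, z <= Z.of_nat n.
Proof. by exists (Z.to_nat z); lia. Qed.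

Lemma step_invariant_const (T : Type) (f : Z -> T) :
  (forall n, f (n + 1) = f n) -> forall n, f n = f 0.
Proof.
move=> f_step; apply: Z.bi_induction => // [n].
by rewrite -Z.add_1_r f_step.
Qed.

(** * Clocks *)

Definition clock : Type := (quarter * bit)%type.
Definition display (u : clock) : quarter := u.1.
Definition tick (u : clock) : bit := u.2.
#[local] Arguments display !u.
#[local] Arguments tick !u.

Lemma clock_eq u v : display u = display v -> tick u = tick v -> u = v.
Proof. by case: u v => [? ?] [? ?] /= -> ->. Qed.

Definition advances (u v : clock) : Prop := display v = (display u + tick v) mod 4 :> Z.
Definition running (u : Z -> clock) : Prop := forall n, advances (u n) (u (n + 1)).

Lemma running_always_ticking u :
  running u -> (forall n, tick (u n) = 1 :> Z) ->
  forall n, display (u n) = (display (u 0) + n) mod 4 :> Z.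
Proof.
move=> run ticks n.
have drift : forall n, (display (u n) - n) mod 4 = (display (u 0) - 0) mod 4.
  apply: (step_invariant_const (f := fun n => (display (u n) - n) mod 4)) => k.
  by have := run k; have := ticks (k + 1); rewrite /advances; lia.
by have := drift n; lia.
Qed.

Definition silent_between (m : Z) (u : Z -> clock) : Prop :=
  forall n d, 0 < d < m -> tick (u (m * n + d)) = 0 :> Z.

(* What a running clock that is silent between the multiples of [m] shows at
   distance [d], with [- m < d < m], from a multiple where it shows [u]. *)
Definition at_offset (d : Z) (u : clock) : clock :=
  match d with
  | Z0 => u
  | Zpos _ => (display u, bit_of 0)
  | Zneg _ => (quarter_of (display u - tick u), bit_of 0)
  end.

Lemma display_at_offset d u : 0 <= d -> display (at_offset d u) = display u.
Proof. by case: d. Qed.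

Lemma tick_at_offset d u : tick (at_offset d u) = if d =? 0 then tick u else bit_of 0.
Proof. by case: d. Qed.

Section Subsampling.

Variables (m : Z) (u : Z -> clock).
Hypotheses (m_gt0 : 0 < m) (run : running u).

Lemma running_refine : running (fun n => at_offset (n mod m) (u (n / m))).
Proof.
have mod_ge0 k : 0 <= k mod m by have := Z.mod_pos_bound k m m_gt0; lia.
move=> n; rewrite /advances !display_at_offset // tick_at_offset.
have [n_div n_mod] := (Z.div_mod n m ltac:(lia), Z.mod_pos_bound n m m_gt0).
have [small|full] : n mod m + 1 < m \/ n mod m + 1 = m by lia.
- rewrite -(Z.div_unique (n + 1) m (n / m) (n mod m + 1)); try lia.
  rewrite -(Z.mod_unique (n + 1) m (n / m) (n mod m + 1)); try lia.
  by have -> : (n mod m + 1 =? 0) = false by [lia]; lia.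
- rewrite -(Z.div_unique (n + 1) m (n / m + 1) 0); try lia.
  rewrite -(Z.mod_unique (n + 1) m (n / m + 1) 0); try lia.
  exact: run.
Qed.

Hypothesis silent : silent_between m u.

Lemma display_silent n d : 0 <= d < m -> display (u (m * n + d)) = display (u (m * n)).
Proof.
case=> d_ge0; move: d d_ge0; apply: natlike_ind => [_|d d_ge0 IH d_lt].
  by rewrite Z.add_0_r.
have := run (m * n + d); have := silent n (d := d + 1) ltac:(lia).
by rewrite -Z.add_assoc Z.add_1_r /advances IH; lia.
Qed.

Lemma running_subsample : running (fun n => u (m * n)).
Proof.
move=> n; have := run (m * n + (m - 1)).
have -> : m * n + (m - 1) + 1 = m * (n + 1) by lia.
by rewrite /advances display_silent; lia.
Qed.

Lemma running_at_offset n d : - m < d < m -> u (m * n + d) = at_offset d (u (m * n)).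
Proof.
case: d => [|d|d] d_bound; first by rewrite Z.add_0_r.
- by apply: clock_eq; rewrite ?display_silent //=; [|have := silent n (d := Zpos d)]; lia.
- have -> : m * n + Zneg d = m * (n - 1) + (m + Zneg d) by lia.
  have := running_subsample (n - 1); have := silent (n - 1) (d := m + Zneg d).
  have -> : n - 1 + 1 = n by lia.
  by rewrite /advances => ? ?; apply: clock_eq; rewrite ?display_silent //=; lia.
Qed.

End Subsampling.

(** * Sides of tiles and local rules *)

(* A side is [(parity, digit, horiz, central)].  In the ideal configuration the
   first side of the tile at [(x, y, z)], where [2^l] is the exact power of 2
   dividing [x], has parity [1] iff [l = 0], digit the binary digit [l + 1] of [x],
   a horizontal clock that displays [floor (y / 2^l) mod 4] and ticks when [2^l]
   divides [y], and a central clock that displays [floor (z / 4^l) mod 4] and ticks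
   when [4^l] divides [z]; the second side is obtained in the same way from
   [(y, x, z - x y)]. *)
Definition side : Type := (bit * bit * clock * clock)%type.

Definition parity (s : side) : bit := s.1.1.1.
Definition digit (s : side) : bit := s.1.1.2.
Definition horiz (s : side) : clock := s.1.2.
Definition central (s : side) : clock := s.2.
#[local] Arguments parity !s.
#[local] Arguments digit !s.
#[local] Arguments horiz !s.
#[local] Arguments central !s.

Definition lift_side (p h : bit) (s : side) : side :=
  (p, digit s, horiz s, (display (central s), h)).

Definition horizontal_step (s t : side) : Prop :=
  parity t = parity s /\ digit t = digit s /\
  advances (horiz s) (horiz t) /\ central t = central s.

Definition central_step (s t : side) : Prop :=
  parity t = parity s /\ digit t = digit s /\
  horiz t = horiz s /\ advances (central s) (central t).

(* An odd plane has level 0: its clocks tick at every step, and it meets the even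
   planes between two ticks of their horizontal clock. *)
Definition odd_rule (s t : side) : Prop :=
  (parity s = 1 :> Z -> tick (horiz s) = 1 :> Z /\ tick (central s) = 1 :> Z) /\
  (parity s = 1 :> Z -> parity t = 0 :> Z -> tick (horiz t) = 0 :> Z).

(* For planes [x = 2^l u] and [y = 2^l v] with [u] and [v] odd,
   [u v = 1 + 2 (u / 2) + 2 (v / 2)] modulo 4. *)
Definition level_rule (e : Z) (s t : side) : Prop :=
  tick (horiz s) = 1 :> Z /\ tick (horiz t) = 1 :> Z /\
  display (horiz s) = 1 + 2 * digit t :> Z /\ display (horiz t) = 1 + 2 * digit s :> Z /\
  tick (central s) = tick (central t) /\
  display (central t) = (display (central s) - e * (1 + 2 * digit s + 2 * digit t)) mod 4 :> Z.

(* The plane of [s] has a smaller level than the plane of [t]; the horizontal clock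
   of [s] displays [2] when the levels differ by exactly one, and [0] otherwise. *)
Definition below_rule (s t : side) : Prop :=
  tick (horiz s) = 1 :> Z /\ tick (horiz t) = 0 :> Z /\
  ((display (horiz s) = 2 :> Z /\ display (horiz t) mod 2 = digit s /\
    (tick (central t) = 1 :> Z <-> tick (central s) = 1 :> Z /\ display (central s) = 2 :> Z)) \/
   (display (horiz s) = 0 :> Z /\
    (tick (central t) = 1 :> Z -> tick (central s) = 1 :> Z /\ display (central s) = 0 :> Z))).

Definition compatible (e : Z) (s t : side) : Prop :=
  level_rule e s t \/ below_rule s t \/ below_rule t s.

Definition crossing (e : Z) (s t : side) : Prop :=
  odd_rule s t /\ odd_rule t s /\ compatible e s t.

Lemma crossing_sym e s t : e = 1 \/ e = -1 -> crossing e s t -> crossing (- e) t s.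
Proof.
move=> unit_e [odd_s [odd_t rule]]; split=> //; split=> //.
case: rule => [rule|[rule|rule]]; [left|by right; right|by right; left].
by move: rule; rewrite /level_rule; case: unit_e => ->; lia.
Qed.

(** * Tilings by two families of planes *)

Record plane := {
  plane_parity : bit;
  plane_digit : bit;
  plane_horiz : Z -> clock;
  plane_central : Z -> clock
}.

Definition running_plane (p : plane) : Prop :=
  running (plane_horiz p) /\ running (plane_central p).

Definition side_at (p : plane) (y z : Z) : side :=
  (plane_parity p, plane_digit p, plane_horiz p y, plane_central p z).

Definition odd_plane (x : Z) : plane :=
  {| plane_parity := bit_of 1;
     plane_digit := bit_of (x / 2);
     plane_horiz y := (quarter_of y, bit_of 1);
     plane_central z := (quarter_of z, bit_of 1) |}.

Definition odd_side (x y z : Z) : side := side_at (odd_plane x) y z.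

Lemma odd_sideE x y z : odd_side x y z =
  (bit_of 1, bit_of (x / 2), (quarter_of y, bit_of 1), (quarter_of z, bit_of 1)).
Proof. by []. Qed.

Ltac read_sides :=
  cbn [odd_side odd_plane side_at lift_side parity digit horiz central
       plane_parity plane_digit plane_horiz plane_central display tick fst snd].

Definition family : Type := Z -> plane.

Definition regular (P : family) : Prop :=
  (forall x, running_plane (P x)) /\
  (forall x, plane_parity (P (x + 1)) = 1 - plane_parity (P x) :> Z).

(* The plane [P x] is [{x} * Z * Z] and [Q y] is [Z * {y} * Z], the latter with
   central coordinate [z - e x y].  The Heisenberg group is the case [e = 1];
   exchanging the two families exchanges the signs [1] and [-1]. *)
Definition tiling (e : Z) (P Q : family) : Prop :=
  [/\ e = 1 \/ e = -1, regular P, regular Q &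
      forall x y z, crossing e (side_at (P x) y z) (side_at (Q y) x (z - e * (x * y)))].

Lemma tiling_crossing e P Q x y z z' : tiling e P Q -> z' = z - e * (x * y) ->
  crossing e (side_at (P x) y z) (side_at (Q y) x z').
Proof. by case=> _ _ _ cr ->. Qed.

Lemma tiling_sym e P Q : tiling e P Q -> tiling (- e) Q P.
Proof.
move=> til; case: (til) => unit_e regP regQ _; split=> //; first lia.
by move=> y x z; apply: crossing_sym => //; apply: tiling_crossing til _; lia.
Qed.

Lemma exists_odd_plane P : regular P -> exists x, plane_parity (P x) = 1 :> Z.
Proof.
case=> _ /(_ 0) alt.
have [?|?] : plane_parity (P 0) = 1 :> Z \/ plane_parity (P (0 + 1)) = 1 :> Z by lia.
  by exists 0.
by exists (0 + 1).
Qed.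

Lemma odd_plane_ticks e P Q x : tiling e P Q -> plane_parity (P x) = 1 :> Z ->
  (forall y, tick (plane_horiz (P x) y) = 1 :> Z) /\
  (forall z, tick (plane_central (P x) z) = 1 :> Z).
Proof.
move=> til odd_x; split=> n.
- by have [[/= /(_ odd_x)[]]] := tiling_crossing (x := x) (y := n) (z := 0) til erefl.
- by have [[/= /(_ odd_x)[]]] := tiling_crossing (x := x) (y := 0) (z := n) til erefl.
Qed.

Lemma odd_plane_horiz e P Q x y : tiling e P Q -> plane_parity (P x) = 1 :> Z ->
  display (plane_horiz (P x) y) = (display (plane_horiz (P x) 0) + y) mod 4 :> Z.
Proof.
move=> til odd_x; have [_ [/(_ x)[run _] _] _ _] := til.
by apply: running_always_ticking => //; have [] := odd_plane_ticks til odd_x.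
Qed.

Lemma odd_plane_central e P Q x z : tiling e P Q -> plane_parity (P x) = 1 :> Z ->
  display (plane_central (P x) z) = (display (plane_central (P x) 0) + z) mod 4 :> Z.
Proof.
move=> til odd_x; have [_ [/(_ x)[_ run] _] _ _] := til.
by apply: running_always_ticking => //; have [] := odd_plane_ticks til odd_x.
Qed.

Lemma odd_planes_level e P Q x y z z' : tiling e P Q ->
  plane_parity (P x) = 1 :> Z -> plane_parity (Q y) = 1 :> Z -> z' = z - e * (x * y) ->
  level_rule e (side_at (P x) y z) (side_at (Q y) x z').
Proof.
move=> til odd_x odd_y E; have [tickP _] := odd_plane_ticks til odd_x.
have [tickQ _] := odd_plane_ticks (tiling_sym til) odd_y.
have [_ [_ [//|[]]]] := tiling_crossing til E; rewrite /below_rule; read_sides.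
  by have := tickQ x; lia.
by have := tickP y; lia.
Qed.

Lemma odd_planes_digit e P Q x y : tiling e P Q ->
  plane_parity (P x) = 1 :> Z -> plane_parity (Q y) = 1 :> Z ->
  display (plane_horiz (Q y) x) = 1 + 2 * plane_digit (P x) :> Z.
Proof.
move=> til odd_x odd_y; have := odd_planes_level (z := 0) til odd_x odd_y erefl.
by rewrite /level_rule; read_sides; tauto.
Qed.

Lemma digit_alternates e P Q x : tiling e P Q -> plane_parity (P x) = 1 :> Z ->
  plane_digit (P (x + 2)) = 1 - plane_digit (P x) :> Z.
Proof.
move=> til odd_x; have [_ [_ alt] regQ _] := til.
have odd_x2 : plane_parity (P (x + 2)) = 1 :> Z.
  have -> : x + 2 = x + 1 + 1 by lia.
  by have := alt x; have := alt (x + 1); lia.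
have [y odd_y] := exists_odd_plane regQ.
have := odd_planes_digit til odd_x odd_y; have := odd_planes_digit til odd_x2 odd_y.
have := odd_plane_horiz x (tiling_sym til) odd_y.
by have := odd_plane_horiz (x + 2) (tiling_sym til) odd_y; lia.
Qed.

Definition anchored (P : family) : Prop :=
  plane_parity (P 0) = 0 :> Z /\ plane_digit (P 1) = 0 :> Z.

Lemma anchored_parity P x : regular P -> anchored P -> plane_parity (P x) = x mod 2 :> Z.
Proof.
case=> _ alt [P0 _].
have drift : forall x, (plane_parity (P x) - x) mod 2 = (plane_parity (P 0) - 0) mod 2.
  apply: (step_invariant_const (f := fun x => (plane_parity (P x) - x) mod 2)) => k.
  by have := alt k; lia.
by have := drift x; lia.
Qed.

Lemma exists_anchor e P Q : tiling e P Q ->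
  exists i, plane_parity (P i) = 0 :> Z /\ plane_digit (P (i + 1)) = 0 :> Z.
Proof.
move=> til; have [_ regP _ _] := til; have [_ alt] := regP.
have [x odd_x] := exists_odd_plane regP.
have [?|?] : plane_digit (P x) = 0 :> Z \/ plane_digit (P x) = 1 :> Z by lia.
- by exists (x - 1); have := alt (x - 1); rewrite Z.sub_add; lia.
- exists (x + 1); have := alt x; have -> : x + 1 + 1 = x + 2 by lia.
  by have := digit_alternates til odd_x; lia.
Qed.

Definition normal (P : family) : Prop :=
  (forall x, plane_parity (P x) = x mod 2 :> Z) /\
  forall x y z, x mod 2 = 1 -> side_at (P x) y z = odd_side x y z.

Lemma anchored_horiz e P Q x y : tiling e P Q -> anchored P -> anchored Q ->
  x mod 2 = 1 -> display (plane_horiz (P x) y) = y mod 4 :> Z.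
Proof.
move=> til anchP anchQ odd_x; have [_ regP regQ _] := til.
have odd_Px : plane_parity (P x) = 1 :> Z by rewrite anchored_parity.
have odd_Q1 : plane_parity (Q 1) = 1 :> Z by rewrite anchored_parity.
have := odd_plane_horiz y til odd_Px; have := odd_plane_horiz 1 til odd_Px.
by have := odd_planes_digit (tiling_sym til) odd_Q1 odd_Px; case: anchQ => _ ->; lia.
Qed.

Section Anchored.

Variables (e : Z) (P Q : family).
Hypotheses (til : tiling e P Q) (anchP : anchored P) (anchQ : anchored Q).

Let odd_parity x : x mod 2 = 1 -> plane_parity (P x) = 1 :> Z.
Proof. by case: til => _ regP _ _; rewrite anchored_parity. Qed.

Let odd_parity1 : plane_parity (Q 1) = 1 :> Z.
Proof. by case: til => _ _ regQ _; rewrite anchored_parity. Qed.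

Lemma anchored_digit x : x mod 2 = 1 -> plane_digit (P x) = (x / 2) mod 2 :> Z.
Proof.
move=> odd_x; have := odd_planes_digit til (odd_parity odd_x) odd_parity1.
by rewrite (anchored_horiz x (tiling_sym til)) //; lia.
Qed.

Lemma anchored_central x : x mod 2 = 1 ->
  display (plane_central (P x) 0) = display (plane_central (Q 1) 0).
Proof.
move=> odd_x; have [unit_e _ _ _] := til.
have [_ [_ [_ [_ [_]]]]] :=
  odd_planes_level (z := e * x) (z' := 0) til (odd_parity odd_x) odd_parity1 ltac:(lia).
have := odd_plane_central (e * x) til (odd_parity odd_x); rewrite /=.
rewrite anchored_digit //; case: anchQ => _ ->.
by case: unit_e => ->; lia.
Qed.

Lemma anchored_normal : display (plane_central (P 1) 0) = 0 :> Z -> normal P.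
Proof.
move=> central0; have [_ regP _ _] := til.
split=> [x|x y z odd_x]; first exact: anchored_parity.
have odd_Px := odd_parity odd_x.
have [ticks_h ticks_c] := odd_plane_ticks til odd_Px.
rewrite /odd_side /side_at; congr (_, _, _, _); try apply: clock_eq; read_sides.
- by lia.
- by rewrite (Z_of_ord_inj (plane_digit _)) anchored_digit //; lia.
- by have := anchored_horiz y til anchP anchQ odd_x; lia.
- by have := ticks_h y; lia.
- have := odd_plane_central z til odd_Px; rewrite anchored_central //.
  by rewrite -(anchored_central (x := 1)) //; lia.
- by have := ticks_c z; lia.
Qed.

End Anchored.

Definition translate (e a b c : Z) (P : family) : family := fun x =>
  {| plane_parity := plane_parity (P (x + a));
     plane_digit := plane_digit (P (x + a));
     plane_horiz y := plane_horiz (P (x + a)) (y + b);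
     plane_central z := plane_central (P (x + a)) (z + c + e * (x * b)) |}.

Lemma translate_regular e a b c P : regular P -> regular (translate e a b c P).
Proof.
case=> run alt; split=> [x|x]; last first.
  by have := alt (x + a); have -> : x + a + 1 = x + 1 + a by lia.
have [run_h run_c] := run (x + a); split=> [y|z].
- by have := run_h (y + b); have -> : y + b + 1 = y + 1 + b by lia.
- have := run_c (z + c + e * (x * b)).
  by have -> : z + c + e * (x * b) + 1 = z + 1 + c + e * (x * b) by lia.
Qed.

Definition cotranslate (e a b c : Z) : family -> family :=
  translate (- e) b a (c - e * (a * b)).

Lemma translate_tiling e a b c P Q : tiling e P Q ->
  tiling e (translate e a b c P) (cotranslate e a b c Q).
Proof.
move=> til; have [unit_e regP regQ _] := til.
split=> //; try exact: translate_regular.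
by move=> x y z; apply: (tiling_crossing til); lia.
Qed.

Definition normal_tiling (e : Z) (P Q : family) : Prop :=
  [/\ tiling e P Q, normal P & normal Q].

Lemma normal_tiling_sym e P Q : normal_tiling e P Q -> normal_tiling (- e) Q P.
Proof. by case=> til nP nQ; split=> //; apply: tiling_sym. Qed.

Lemma anchored_normal_tiling e P Q : tiling e P Q -> anchored P -> anchored Q ->
  display (plane_central (P 1) 0) = 0 :> Z -> normal_tiling e P Q.
Proof.
move=> til anchP anchQ central0; split=> //; first exact: anchored_normal til _ _ _.
apply: (anchored_normal (tiling_sym til)) => //.
by rewrite -(anchored_central til anchP anchQ (x := 1)).
Qed.

Lemma tiling_normalize e P Q : tiling e P Q -> exists a b c,
  normal_tiling e (translate e a b c P) (cotranslate e a b c Q).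
Proof.
move=> til; have [i [even_i digit_i]] := exists_anchor til.
have [j [even_j digit_j]] := exists_anchor (tiling_sym til).
have [_ [_ alt] _ _] := til.
have odd_i1 : plane_parity (P (i + 1)) = 1 :> Z by have := alt i; lia.
exists i, j, (- (e * j) - display (plane_central (P (i + 1)) 0)).
apply: anchored_normal_tiling; first exact: translate_tiling.
- by rewrite /anchored /= Z.add_0_l Z.add_comm.
- by rewrite /anchored /= Z.add_0_l Z.add_comm.
- rewrite /= [1 + i]Z.add_comm (odd_plane_central _ til odd_i1); lia.
Qed.

(** * Desubstitution *)

Lemma normal_even_odd e P Q x y z : normal_tiling e P Q -> x mod 2 = 0 -> y mod 2 = 1 ->
  tick (plane_horiz (P x) y) = 0 :> Z /\
  ((x mod 4 = 2 /\ display (plane_horiz (P x) y) mod 2 = (y / 2) mod 2 /\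
    (tick (plane_central (P x) z) = 1 :> Z <-> (z - e * (x * y)) mod 4 = 2)) \/
   (x mod 4 = 0 /\
    (tick (plane_central (P x) z) = 1 :> Z -> (z - e * (x * y)) mod 4 = 0))).
Proof.
case=> til [parityP _] [_ oddQ] even_x odd_y.
have [_ [odd_rule_Q rule]] := tiling_crossing til (erefl (z - e * (x * y))).
have silent : tick (plane_horiz (P x) y) = 0 :> Z.
  have := proj2 odd_rule_Q; rewrite oddQ //; read_sides; have := parityP x; lia.
split=> //; case: rule => [|[|]]; rewrite /level_rule /below_rule oddQ //; read_sides; lia.
Qed.

Section EvenPlanes.

Variables (e : Z) (P Q : family).
Hypothesis nor : normal_tiling e P Q.

Lemma even_plane_horiz_silent x : x mod 2 = 0 -> silent_between 2 (plane_horiz (P x)).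
Proof. by move=> even_x y d ?; case: (normal_even_odd (y := 2 * y + d) 0 nor even_x); lia. Qed.

Lemma even_plane_central_silent x : x mod 2 = 0 -> silent_between 4 (plane_central (P x)).
Proof.
move=> even_x z d ?; have [[unit_e _ _ _] _ _] := nor.
have := normal_even_odd (y := 1) (4 * z + d) nor even_x erefl.
by case: unit_e => ->; lia.
Qed.

Lemma level1_central_ticks x z :
  x mod 4 = 2 -> tick (plane_central (P x) (4 * z)) = 1 :> Z.
Proof.
move=> x_mod4; have [[unit_e _ _ _] _ _] := nor.
have := normal_even_odd (y := 1) (4 * z) nor (x := x) ltac:(lia) erefl.
by case: unit_e => ->; lia.
Qed.

Lemma level1_horiz_ticks x y : x mod 4 = 2 -> tick (plane_horiz (P x) (2 * y)) = 1 :> Z.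
Proof.
move=> x_mod4; have even_x : x mod 2 = 0 by lia.
have := normal_even_odd (y := 2 * y + -1) 0 nor even_x ltac:(lia).
have := normal_even_odd (y := 2 * y + 1) 0 nor even_x ltac:(lia).
have [[_ [/(_ x)[run _] _] _ _] _ _] := nor.
have offset := running_at_offset _ run (even_plane_horiz_silent even_x) y.
by rewrite !offset //=; lia.
Qed.

End EvenPlanes.

Lemma level_ge2_horiz_silent e P Q x y : normal_tiling e P Q ->
  x mod 4 = 0 -> y mod 4 = 2 -> tick (plane_horiz (P x) y) = 0 :> Z.
Proof.
move=> nor x_mod4 y_mod4; have [til _ _] := nor; have nor' := normal_tiling_sym nor.
have Ex : x = 2 * (x / 2) by lia.
have := level1_horiz_ticks nor' (x / 2) y_mod4; rewrite -Ex => tick_Q.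
have := normal_even_odd (y := x + 1) 0 nor' (x := y) ltac:(lia) ltac:(lia).
have [_ _ [/(_ y)[run _] _] _] := til.
have := running_at_offset _ run (even_plane_horiz_silent nor' _) (x / 2) (d := 1).
rewrite -Ex => -> //; [rewrite display_at_offset //|lia].
have := tiling_crossing til (erefl (0 - e * (x * y))).
by rewrite /crossing /compatible /level_rule /below_rule; read_sides; lia.
Qed.

Definition coarse (P : family) : family := fun x =>
  {| plane_parity := bit_of x;
     plane_digit := plane_digit (P (2 * x));
     plane_horiz y := plane_horiz (P (2 * x)) (2 * y);
     plane_central z := plane_central (P (2 * x)) (4 * z) |}.

Definition refine (dy dz : Z) (s : side) : side :=
  (bit_of 0, digit s, at_offset dy (horiz s), at_offset dz (central s)).

Lemma refineE dy dz (p r f h : bit) (q k : quarter) : 0 <= dy -> 0 <= dz ->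
  refine dy dz (p, r, (q, f), (k, h)) =
  (bit_of 0, r, (q, if dy =? 0 then f else bit_of 0), (k, if dz =? 0 then h else bit_of 0)).
Proof. by case: dy => [|?|?] //; case: dz. Qed.

Lemma side_at_refine e P Q x y z dy dz : normal_tiling e P Q ->
  - 2 < dy < 2 -> - 4 < dz < 4 ->
  side_at (P (2 * x)) (2 * y + dy) (4 * z + dz) = refine dy dz (side_at (coarse P x) y z).
Proof.
move=> nor dy_bound dz_bound; have even_2x : (2 * x) mod 2 = 0 by lia.
have [[_ [/(_ (2 * x))[run_h run_c] _] _ _] [parityP _] _] := nor.
rewrite /side_at /refine; congr (_, _, _, _); first by have := parityP (2 * x); lia.
- exact: running_at_offset (even_plane_horiz_silent nor even_2x) _ _ _.
- exact: running_at_offset (even_plane_central_silent nor even_2x) _ _ _.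
Qed.

Lemma coarse_regular e P Q : normal_tiling e P Q -> regular (coarse P).
Proof.
move=> nor; have [[_ [run _] _ _] _ _] := nor.
split=> [x|x]; last by rewrite /=; lia.
have [run_h run_c] := run (2 * x); have even_2x : (2 * x) mod 2 = 0 by lia.
split; first exact: running_subsample run_h (even_plane_horiz_silent nor even_2x).
exact: running_subsample run_c (even_plane_central_silent nor even_2x).
Qed.

Lemma coarse_odd_rule e P Q x y z z' : normal_tiling e P Q ->
  odd_rule (side_at (coarse P x) y z) (side_at (coarse Q y) x z').
Proof.
move=> nor; rewrite /coarse; split; read_sides.
  by move=> odd_x; split; [apply: (level1_horiz_ticks nor)|apply: (level1_central_ticks nor)]; lia.
by move=> odd_x even_y; apply: (level_ge2_horiz_silent (normal_tiling_sym nor)); lia.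
Qed.

Lemma coarse_tiling e P Q : normal_tiling e P Q -> tiling e (coarse P) (coarse Q).
Proof.
move=> nor; have nor' := normal_tiling_sym nor; have [til _ _] := nor.
split; [by case: til|exact: coarse_regular nor|exact: coarse_regular nor'|move=> x y z].
split; first exact: coarse_odd_rule nor; split; first exact: coarse_odd_rule nor'.
have E : 4 * (z - e * (x * y)) = 4 * z - e * (2 * x * (2 * y)) by lia.
by have [_ [_]] := tiling_crossing til E.
Qed.

(** * Realization of all admissible crossings *)

Definition realized (e : Z) (P Q : family) (s t : side) : Prop :=
  exists x y z, side_at (P x) y z = s /\ side_at (Q y) x (z - e * (x * y)) = t.

Lemma realized_sym e P Q s t : realized e P Q s t -> realized (- e) Q P t s.
Proof.
case=> x [y [z [Es Et]]]; exists y, x, (z - e * (x * y)); split=> //.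
by have -> : z - e * (x * y) - - e * (y * x) = z by lia.
Qed.

Lemma realized_crossing e P Q s t : tiling e P Q -> realized e P Q s t -> crossing e s t.
Proof. by move=> til [x [y [z [<- <-]]]]; apply: tiling_crossing til _. Qed.

Lemma realized_translate e a b c P Q s t :
  realized e (translate e a b c P) (cotranslate e a b c Q) s t ->
  realized e P Q s t.
Proof.
case=> x [y [z [Es Et]]].
exists (x + a), (y + b), (z + c + e * (x * b)); split=> //; rewrite -Et.
by congr (_, _, _, plane_central _ _); lia.
Qed.

Lemma realized_normal e P Q : tiling e P Q -> exists P' Q', normal_tiling e P' Q' /\
  forall s t, realized e P' Q' s t -> realized e P Q s t.
Proof.
move=> /tiling_normalize [a [b [c nor]]]; do 2 eexists; split; first exact: nor.
by move=> s t; apply: realized_translate.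
Qed.

Lemma realized_refine e P Q s t d : normal_tiling e P Q -> 0 <= d < 4 ->
  realized e (coarse P) (coarse Q) s t -> realized e P Q (refine 0 d s) (refine 0 d t).
Proof.
move=> nor d_bound [x [y [z [Es Et]]]].
exists (2 * x), (2 * y), (4 * z + d); split.
  by rewrite -Es -(side_at_refine _ _ _ nor) ?Z.add_0_r //; lia.
rewrite -Et -(side_at_refine _ _ _ (normal_tiling_sym nor)) ?Z.add_0_r; try lia.
by congr side_at; lia.
Qed.

Lemma coarse_realized_parity e P Q s t : realized e (coarse P) (coarse Q) s t ->
  exists x y z, [/\ side_at (coarse P x) y z = s,
    side_at (coarse Q y) x (z - e * (x * y)) = t, parity s = bit_of x & parity t = bit_of y].
Proof. by case=> x [y [z [Es Et]]]; exists x, y, z; rewrite -Es -Et. Qed.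

Lemma odd_side_realized e P Q r q k : tiling e P Q ->
  exists t, realized e P Q (bit_of 1, r, (q, bit_of 1), (k, bit_of 1)) t.
Proof.
move=> /realized_normal [P' [Q' [[_ [_ oddP] _] real]]].
eexists; apply: real; exists (1 + 2 * r), q, k; split; last by [].
by rewrite oddP ?odd_sideE; [congr (_, _, (_, _), (_, _))|]; lia.
Qed.

Lemma even_side_realized e P Q r q (p : bit) k h : tiling e P Q ->
  exists t, realized e P Q (bit_of 0, r, (q, bit_of (1 - p)), (k, h)) t /\ parity t = p.
Proof.
move=> /realized_normal [P' [Q' [nor real]]]; have [_ _ [parityQ _]] := nor.
have [t [x [y [z [Es _]]]]] := odd_side_realized r q k (coarse_tiling nor).
eexists; split.
  apply: real; exists (2 * x), (2 * y + p), (4 * z + (1 - h)); split; last by [].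
  rewrite (side_at_refine _ _ _ nor) ?Es; try lia.
  by rewrite refineE; [congr (_, _, (_, _), (_, _)); case: Z.eqb_spec| |]; lia.
by read_sides; have := parityQ (2 * y + p); lia.
Qed.

Lemma odd_odd_realized e P Q s t : tiling e P Q -> crossing e s t ->
  parity s = 1 :> Z -> parity t = 1 :> Z -> realized e P Q s t.
Proof.
move=> til cr odd_s odd_t.
have [P' [Q' [[[unit_e _ _ _] [_ oddP] [_ oddQ]] real]]] := realized_normal til; apply: real.
case: cr => [[+ _] [[+ _]]] => /(_ odd_s) ticks_s /(_ odd_t) ticks_t.
move: s t odd_s odd_t ticks_s ticks_t.
case=> [[[ps r] [q f]] [k h]] [[[pt r'] [q' f']] [k' h']].
rewrite /compatible /level_rule /below_rule; read_sides => ? ? ? ? rule.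
exists q', q, k; rewrite oddP ?oddQ ?odd_sideE; try lia.
by split; congr (_, _, (_, _), (_, _)); case: unit_e rule => ->; lia.
Qed.

Lemma even_odd_realized_of_coarse e P Q s t s' t' d : normal_tiling e P Q ->
  realized e (coarse P) (coarse Q) s' t' -> 0 <= d < 4 -> s = refine 1 d s' ->
  t = (bit_of 1, parity t', (quarter_of (2 * parity s'), bit_of 1),
       (quarter_of (d + 2 * parity s'), bit_of 1)) ->
  realized e P Q s t.
Proof.
move=> nor /coarse_realized_parity [x [y [z [Es _ -> ->]]]] d_bound -> ->.
have [[unit_e _ _ _] _ [_ oddQ]] := nor.
exists (2 * x), (2 * y + 1), (4 * z + d); split.
  by rewrite -Es (side_at_refine _ _ _ nor) //; lia.
by rewrite oddQ ?odd_sideE; [case: unit_e => ->; congr (_, _, (_, _), (_, _))|]; lia.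
Qed.

Lemma crossing_odd_parity e s t : crossing e s t -> parity s = 1 :> Z ->
  parity t = display (horiz s) mod 2 :> Z.
Proof.
move=> [[ticks_s off_s] [[ticks_t _] rule]] odd_s; have {}ticks_s := ticks_s odd_s.
by case: rule => [|[|]]; rewrite /level_rule /below_rule; lia.
Qed.

Lemma crossing_even_odd e s t : crossing e s t -> parity s = 0 :> Z -> parity t = 1 :> Z ->
  tick (horiz s) = 0 :> Z /\ tick (horiz t) = 1 :> Z /\ tick (central t) = 1 :> Z /\
  ((display (horiz t) = 2 :> Z /\ display (horiz s) mod 2 = digit t /\
    (tick (central s) = 1 :> Z <-> display (central t) = 2 :> Z)) \/
   (display (horiz t) = 0 :> Z /\
    (tick (central s) = 1 :> Z -> display (central t) = 0 :> Z))).
Proof.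
move=> [_ [[ticks off] rule]] even_s odd_t.
have {ticks off} := (ticks odd_t, off odd_t even_s) => -[[]].
by case: rule => [|[|]]; rewrite /level_rule /below_rule; lia.
Qed.

Lemma even_odd_realized e P Q s t : tiling e P Q -> crossing e s t ->
  parity s = 0 :> Z -> parity t = 1 :> Z -> realized e P Q s t.
Proof.
move=> til cr even_s odd_t; have [P' [Q' [nor real]]] := realized_normal til; apply: real.
have til' := coarse_tiling nor.
have := crossing_even_odd cr even_s odd_t; clear cr.
move: s t even_s odd_t => [[[ps r] [q f]] [k h]] [[[pt r'] [q' f']] [k' h']].
read_sides => even_s odd_t [f0 [f'1 [h'1 [[q'2 [qr' hk']]|[q'0 hk']]]]].
- have [t' real'] := odd_side_realized r q k til'.
  have := crossing_odd_parity (realized_crossing til' real'); read_sides => parity_t'.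
  have {}parity_t' := parity_t' (residueK 1 1).
  apply: (even_odd_realized_of_coarse nor real' (d := (k' - 2) mod 4)); first lia.
    by rewrite refineE //; [congr (_, _, (_, _), (_, _)); try case: Z.eqb_spec|]; lia.
  by congr (_, _, (_, _), (_, _)); read_sides; lia.
- have [t' [real' parity_t']] := even_side_realized r q r' k h til'.
  apply: (even_odd_realized_of_coarse nor real' (d := k')); first lia.
    by rewrite refineE //; [congr (_, _, (_, _), (_, _)); try case: Z.eqb_spec|]; lia.
  by congr (_, _, (_, _), (_, _)); read_sides; lia.
Qed.

Lemma odd_even_realized e P Q s t : tiling e P Q -> crossing e s t ->
  parity s = 1 :> Z -> parity t = 0 :> Z -> realized e P Q s t.
Proof.
move=> til cr odd_s even_t; rewrite -[e]Z.opp_involutive; apply: realized_sym.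
by apply: even_odd_realized; [exact: tiling_sym|apply: crossing_sym; case: til|..].
Qed.

Lemma refine_lift d p h s : 0 <= d -> parity s = 0 :> Z ->
  tick (central s) = (if d =? 0 then h else bit_of 0) -> refine 0 d (lift_side p h s) = s.
Proof.
move: s => [[[p' r] [q f]] [k h']] d_ge0; read_sides => even_s ->.
by rewrite /lift_side; read_sides; rewrite refineE //; congr (_, _, _, _); lia.
Qed.

Lemma level_even_realized e P Q s t : tiling e P Q -> level_rule e s t ->
  parity s = 0 :> Z -> parity t = 0 :> Z -> realized e P Q s t.
Proof.
move=> til rule even_s even_t; have [P' [Q' [nor real]]] := realized_normal til; apply: real.
pose d := 1 - tick (central s).
have Es : refine 0 d (lift_side (bit_of 1) (bit_of 1) s) = s.
  by apply: refine_lift => //; rewrite /d; [|case: Z.eqb_spec]; lia.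
have Et : refine 0 d (lift_side (bit_of 1) (bit_of 1) t) = t.
  have [_ [_ [_ [_ [ticks _]]]]] := rule.
  by apply: refine_lift => //; rewrite /d; [|case: Z.eqb_spec]; lia.
rewrite -Es -Et; apply: realized_refine => //; first by lia.
apply: odd_odd_realized; [exact: coarse_tiling nor| |exact: residueK|exact: residueK].
rewrite /crossing /odd_rule /compatible; split; [|split; [|left]]; move: rule;
  rewrite /level_rule; read_sides; lia.
Qed.

Lemma below_even_realized e P Q s t : tiling e P Q -> below_rule s t ->
  parity s = 0 :> Z -> parity t = 0 :> Z -> realized e P Q s t.
Proof.
move=> til rule even_s even_t; have [P' [Q' [nor real]]] := realized_normal til; apply: real.
pose d := 1 - tick (central s).
pose h := if display (horiz s) =? 2 then bit_of (if display (central s) =? 2 then 1 else 0)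
          else tick (central t).
have Es : refine 0 d (lift_side (bit_of 1) (bit_of 1) s) = s.
  by apply: refine_lift => //; rewrite /d; [|case: Z.eqb_spec]; lia.
have Et : refine 0 d (lift_side (bit_of 0) h t) = t.
  apply: refine_lift => //; rewrite /d; first by lia.
  by move: rule; rewrite /below_rule /h; do ! case: Z.eqb_spec; lia.
rewrite -Es -Et; apply: realized_refine => //; first by lia.
apply: odd_even_realized; [exact: coarse_tiling nor| |exact: residueK|exact: residueK].
rewrite /crossing /odd_rule /compatible; split; [|split; [|right; left]]; move: rule;
  rewrite /below_rule /h; read_sides; do ? case: Z.eqb_spec; lia.
Qed.

Lemma crossing_realized e P Q s t : tiling e P Q -> crossing e s t -> realized e P Q s t.
Proof.
move=> til cr; have [_ [_ rule]] := cr.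
have [odd_s|even_s] : parity s = 1 :> Z \/ parity s = 0 :> Z by lia.
all: have [odd_t|even_t] : parity t = 1 :> Z \/ parity t = 0 :> Z by lia.
- exact: odd_odd_realized.
- exact: odd_even_realized.
- exact: even_odd_realized.
- case: rule => [rule|[rule|rule]].
  + exact: level_even_realized.
  + exact: below_even_realized.
  + rewrite -[e]Z.opp_involutive; apply: realized_sym.
    by apply: below_even_realized; first exact: tiling_sym.
Qed.

(** * The shift of finite type *)

Definition tile : Type := (side * side)%type.

Definition gX : H3 := (1, 0, 0).
Definition gY : H3 := (0, 1, 0).
Definition gZ : H3 := (0, 0, 1).

Definition ruleX (t u : tile) : Prop :=
  parity u.1 = 1 - parity t.1 :> Z /\ horizontal_step t.2 u.2.
Definition ruleY (t u : tile) : Prop :=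
  horizontal_step t.1 u.1 /\ parity u.2 = 1 - parity t.2 :> Z.
Definition ruleZ (t u : tile) : Prop := central_step t.1 u.1 /\ central_step t.2 u.2.

Definition Omega : cset tile := fun w =>
  (forall g, crossing 1 (w g).1 (w g).2) /\
  (forall g, ruleX (w g) (w (h3_mul gX g))) /\
  (forall g, ruleY (w g) (w (h3_mul gY g))) /\
  (forall g, ruleZ (w g) (w (h3_mul gZ g))).

Lemma Omega_SFT : is_SFT Omega.
Proof.
apply: is_SFT_and; first exact: (pair_rule_SFT (fun t _ : tile => crossing 1 t.1 t.2) h3_one).
by apply: is_SFT_and; [|apply: is_SFT_and]; exact: pair_rule_SFT.
Qed.

Lemma Omega_shift : shift_invariant Omega.
Proof. exact: SFT_shift_invariant Omega_SFT. Qed.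

Definition assemble (P Q : family) : config tile := fun g =>
  let '(x, y, z) := g in (side_at (P x) y z, side_at (Q y) x (z - x * y)).

Lemma assemble_Omega P Q : tiling 1 P Q -> Omega (assemble P Q).
Proof.
move=> til; have [_ [runP altP] [runQ altQ] _] := til.
split; [|split; [|split]] => -[[x y] z]; have [runPh runPc] := runP x;
  have [runQh runQc] := runQ y; rewrite /gX /gY /gZ ?h3_mulE /assemble.
- by apply: tiling_crossing til _; lia.
- have -> : 0 + z + 1 * y - (1 + x) * (0 + y) = z - x * y by lia.
  by rewrite [1 + x]Z.add_comm; split; [exact: altP|do 2 (split=> //); split; [exact: runQh|]].
- have -> : 0 + z + 0 * y = z by lia.
  rewrite [1 + y]Z.add_comm; split; last exact: altQ.
  by do 2 (split=> //); split; [exact: runPh|].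
- have -> : 1 + z + 0 * y - (0 + x) * (0 + y) = z - x * y + 1 by lia.
  have -> : 1 + z + 0 * y = z + 1 by lia.
  by split; do 3 (split=> //); [exact: runPc|exact: runQc].
Qed.

Definition plane_of (L : Z -> Z -> side) : plane :=
  {| plane_parity := parity (L 0 0);
     plane_digit := digit (L 0 0);
     plane_horiz y := horiz (L y 0);
     plane_central z := central (L 0 z) |}.

Definition stepping (L : Z -> Z -> side) : Prop :=
  (forall y z, horizontal_step (L y z) (L (y + 1) z)) /\
  (forall y z, central_step (L y z) (L y (z + 1))).

Lemma side_at_plane_of L y z : stepping L -> side_at (plane_of L) y z = L y z.
Proof.
case=> hor cen.
have along_y z' : (parity (L y z'), digit (L y z'), central (L y z')) =
    (parity (L 0 z'), digit (L 0 z'), central (L 0 z')).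
  apply: (step_invariant_const (f := fun y => (parity (L y z'), digit (L y z'), _))) => y'.
  by have [-> [-> [_ ->]]] := hor y' z'.
have along_z : (parity (L y z), digit (L y z), horiz (L y z)) =
    (parity (L y 0), digit (L y 0), horiz (L y 0)).
  apply: (step_invariant_const (f := fun z => (parity (L y z), digit (L y z), _))) => z'.
  by have [-> [-> [-> _]]] := cen y z'.
rewrite /side_at /=; move: (along_y z) (along_y 0) along_z => [_ _ <-] [<- <- _] [<- <- <-].
by case: (L y z) => [[[? ?] ?] ?].
Qed.

Lemma plane_of_running L : stepping L -> running_plane (plane_of L).
Proof.
by case=> hor cen; split=> n; [have [_ [_ []]] := hor n 0|have [_ [_ []]] := cen 0 n].
Qed.

Definition first_sides (w : config tile) (x y z : Z) : side := (w (x, y, z)).1.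
Definition second_sides (w : config tile) (y x z : Z) : side := (w (x, y, z + x * y)).2.

Lemma Omega_first_stepping w x : Omega w -> stepping (first_sides w x).
Proof.
case=> _ [_ [stepY stepZ]]; split=> y z; rewrite /first_sides.
- have [+ _] := stepY (x, y, z); rewrite /gY h3_mulE.
  by have -> : (0 + x, 1 + y, 0 + z + 0 * y) = (x, y + 1, z) by congr (_, _, _); lia.
- have [+ _] := stepZ (x, y, z); rewrite /gZ h3_mulE.
  by have -> : (0 + x, 0 + y, 1 + z + 0 * y) = (x, y, z + 1) by congr (_, _, _); lia.
Qed.

Lemma Omega_second_stepping w y : Omega w -> stepping (second_sides w y).
Proof.
case=> _ [stepX [_ stepZ]]; split=> x z; rewrite /second_sides.
- have [_ +] := stepX (x, y, z + x * y); rewrite /gX h3_mulE.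
  by have -> : (1 + x, 0 + y, 0 + (z + x * y) + 1 * y) = (x + 1, y, z + (x + 1) * y)
    by congr (_, _, _); lia.
- have [_ +] := stepZ (x, y, z + x * y); rewrite /gZ h3_mulE.
  by have -> : (0 + x, 0 + y, 1 + (z + x * y) + 0 * y) = (x, y, z + 1 + x * y)
    by congr (_, _, _); lia.
Qed.

Lemma Omega_assemble w : Omega w -> exists P Q, tiling 1 P Q /\ w = assemble P Q.
Proof.
move=> Omega_w; have [cross_w [stepX [stepY _]]] := Omega_w.
pose P x := plane_of (first_sides w x); pose Q y := plane_of (second_sides w y).
have first_w x := Omega_first_stepping x Omega_w.
have second_w y := Omega_second_stepping y Omega_w.
have wE : w = assemble P Q.
  apply: functional_extensionality => -[[x y] z]; rewrite /assemble !side_at_plane_of //.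
  by rewrite /first_sides /second_sides Z.sub_add; case: (w _).
exists P, Q; split=> //; split; first by left.
- split=> x; first exact: plane_of_running.
  by have [+ _] := stepX (x, 0, 0); rewrite /gX h3_mulE [1 + x]Z.add_comm.
- split=> y; first exact: plane_of_running.
  by have [_ +] := stepY (0, y, 0); rewrite /gY h3_mulE [1 + y]Z.add_comm.
- by move=> x y z; have := cross_w (x, y, z); rewrite {1 2}wE /assemble Z.mul_1_l.
Qed.

Definition normalized (w : config tile) : Prop :=
  exists P Q, normal_tiling 1 P Q /\ w = assemble P Q.

Lemma shift_assemble a b c P Q : shift (a, b, c) (assemble P Q) =
  assemble (translate 1 a b c P) (cotranslate 1 a b c Q).
Proof.
apply: functional_extensionality => -[[x y] z]; rewrite /shift h3_mulE /assemble /side_at /=.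
by congr (_, _, _, plane_central _ _, (_, _, _, plane_central _ _)); lia.
Qed.

Lemma Omega_normalize w : Omega w -> exists a, normalized (shift a w).
Proof.
move=> /Omega_assemble [P [Q [til ->]]]; have [a [b [c nor]]] := tiling_normalize til.
by exists (a, b, c); rewrite shift_assemble; do 2 eexists; split; first exact: nor.
Qed.

Lemma tile_occurs w t : Omega w -> crossing 1 t.1 t.2 -> exists g, w g = t.
Proof.
move=> /Omega_assemble [P [Q [til ->]]] cr.
have [x [y [z [Es Et]]]] := crossing_realized til cr.
by exists (x, y, z); rewrite /assemble Es -[x * y]Z.mul_1_l Et; case: t {cr Es Et}.
Qed.

Definition dilate (g : H3) : H3 := let '(x, y, z) := g in (2 * x, 2 * y, 4 * z).

Lemma dilateM g h : dilate (h3_mul g h) = h3_mul (dilate g) (dilate h).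
Proof. by case: g h => [[? ?] ?] [[? ?] ?]; rewrite /dilate; h3_eq. Qed.

Definition set_parity (n : Z) (s : side) : side := (bit_of n, digit s, horiz s, central s).

Definition desub (w : config tile) : config tile := fun g => let '(x, y, _) := g in
  (set_parity x (w (dilate g)).1, set_parity y (w (dilate g)).2).

Lemma desub_assemble P Q : desub (assemble P Q) = assemble (coarse P) (coarse Q).
Proof.
apply: functional_extensionality => -[[x y] z].
rewrite /desub /dilate /assemble /set_parity /side_at /=.
by congr (_, (_, _, _, plane_central _ _)); lia.
Qed.

Lemma desub_Omega w : normalized w -> Omega (desub w).
Proof.
case=> P [Q [nor ->]]; rewrite desub_assemble; exact: assemble_Omega (coarse_tiling nor).
Qed.

(** * Aperiodicity *)

Lemma normalized_period w p : normalized w -> cfg_eq (shift p w) w ->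
  exists q, p = dilate q /\ cfg_eq (shift q (desub w)) (desub w).
Proof.
case: p => [[a b] c] [P [Q [[_ [parityP oddP] _] wE]]] period.
have [Ea [Eb Ec]] : a mod 4 = 0 /\ b mod 4 = 0 /\ c mod 4 = 0.
  have := congr1 fst (period (1, 0, 0)); rewrite /shift h3_mulE wE /assemble /fst.
  move=> Eside; have := congr1 parity Eside; rewrite {1}/side_at /parity /= => Eparity.
  have odd_a : (1 + a) mod 2 = 1.
    by have := parityP (1 + a); have := parityP 1; rewrite Eparity; lia.
  by move: Eside; rewrite !oddP //; case; lia.
exists (a / 2, b / 2, c / 4).
have pE : (a, b, c) = dilate (a / 2, b / 2, c / 4) by rewrite /dilate; congr (_, _, _); lia.
split=> // -[[x y] z]; rewrite /shift h3_mulE {1}/desub -h3_mulE dilateM -pE.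
rewrite -/(shift (a, b, c) w (dilate (x, y, z))) period /desub.
by rewrite /set_parity; congr (_, _, _, _, (_, _, _, _)); lia.
Qed.

Lemma Omega_period_descent w a b c : Omega w -> cfg_eq (shift (a, b, c) w) w ->
  exists w' a' b' c', [/\ Omega w', cfg_eq (shift (a', b', c') w') w',
    a = 2 * a', b = 2 * b' & a = 0 -> b = 0 -> c = 4 * c'].
Proof.
move=> Omega_w period; have [[[i j] k] nor] := Omega_normalize Omega_w.
have := period_conj (i, j, k) period; rewrite h3_conjE => /(normalized_period nor).
move=> [[[a' b'] c'] [[Ea Eb Ec] period']].
by exists (desub (shift (i, j, k) w)), a', b', c'; split=> //; [exact: desub_Omega|lia].
Qed.

Lemma Omega_period_central w a b c :
  Omega w -> cfg_eq (shift (a, b, c) w) w -> a = 0 /\ b = 0.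
Proof.
have [n] := exists_nat_ge (Z.abs a + Z.abs b).
elim: n w a b c => [|n IH] w a b c bound Omega_w period; first lia.
have [w' [a' [b' [c' [Omega_w' period' Ea Eb _]]]]] := Omega_period_descent Omega_w period.
have [?|bound'] : a = 0 /\ b = 0 \/ Z.abs a' + Z.abs b' <= Z.of_nat n by lia.
  by [].
by have := IH w' a' b' c' bound' Omega_w' period'; lia.
Qed.

Lemma Omega_central_period_trivial w c : Omega w -> cfg_eq (shift (0, 0, c) w) w -> c = 0.
Proof.
have [n] := exists_nat_ge (Z.abs c).
elim: n w c => [|n IH] w c bound Omega_w period; first lia.
have [w' [a' [b' [c' [Omega_w' period' Ea Eb Ec]]]]] := Omega_period_descent Omega_w period.
have [?|bound'] : c = 0 \/ Z.abs c' <= Z.of_nat n by lia.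
  by [].
have [a'0 b'0] : a' = 0 /\ b' = 0 by lia.
by rewrite a'0 b'0 in period'; have := IH w' c' bound' Omega_w' period'; lia.
Qed.

Lemma Omega_strongly_aperiodic : strongly_aperiodic Omega.
Proof.
move=> w [[a b] c] Omega_w period.
have [a0 b0] := Omega_period_central Omega_w period; rewrite a0 b0 in period *.
by rewrite (Omega_central_period_trivial Omega_w period).
Qed.

(** * Recurrence *)

Lemma odd_first w x y z : normalized w -> x mod 2 = 1 -> (w (x, y, z)).1 = odd_side x y z.
Proof. by case=> P [Q [[_ [_ oddP] _] ->]]; exact: oddP. Qed.

Lemma odd_second w x y z : normalized w -> y mod 2 = 1 ->
  (w (x, y, z)).2 = odd_side y x (z - x * y).
Proof. by case=> P [Q [[_ _ [_ oddQ]] ->]]; exact: oddQ. Qed.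

Lemma refine_first w x y z dy dz : normalized w -> - 2 < dy < 2 -> - 4 < dz < 4 ->
  (w (2 * x, 2 * y + dy, 4 * z + dz)).1 = refine dy dz (desub w (x, y, z)).1.
Proof.
case=> P [Q [nor ->]] dy_bound dz_bound; rewrite desub_assemble.
exact: side_at_refine nor dy_bound dz_bound.
Qed.

Lemma refine_second w x y z dx dz : normalized w -> - 2 < dx < 2 -> - 4 < dz < 4 ->
  (w (2 * x + dx, 2 * y, 4 * z + dz + 2 * dx * y)).2 = refine dx dz (desub w (x, y, z)).2.
Proof.
case=> P [Q [nor ->]] dx_bound dz_bound; rewrite desub_assemble /assemble.
rewrite -(side_at_refine _ _ _ (normal_tiling_sym nor)) //.
by congr side_at; lia.
Qed.

(* The bound on [z] is the largest one stable under the recursion of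
   [desub_agree_ball]; it has to exceed half of the spacing [4^k] of the vertices. *)
Definition ball (k : nat) (g : H3) : Prop := let '(x, y, z) := g in
  Z.abs x < 2 ^ Z.of_nat k /\ Z.abs y < 2 ^ Z.of_nat k /\
  3 * Z.abs z + 2 < 2 * 4 ^ Z.of_nat k + 3 * 2 ^ Z.of_nat k.

Lemma pow_of_natS b k : b ^ Z.of_nat k.+1 = b * b ^ Z.of_nat k.
Proof. by rewrite Nat2Z.inj_succ Z.pow_succ_r //; lia. Qed.

Lemma pow_of_nat_gt0 b k : 0 < b -> 0 < b ^ Z.of_nat k.
Proof. by move=> b_gt0; apply: Z.pow_pos_nonneg; lia. Qed.

Lemma ball_one k : ball k h3_one.
Proof.
have := pow_of_nat_gt0 (b := 2) k; have := pow_of_nat_gt0 (b := 4) k.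
by rewrite /ball /h3_one; lia.
Qed.

Lemma ball_even_first k x y z : ball k.+1 (2 * x, y, z) -> exists y' z' dy dz,
  [/\ y = 2 * y' + dy, z = 4 * z' + dz, - 2 < dy < 2, - 4 < dz < 4 & ball k (x, y', z')].
Proof.
rewrite /ball !pow_of_natS.
have := pow_of_nat_gt0 (b := 2) k; have := pow_of_nat_gt0 (b := 4) k.
by exists (Z.quot y 2), (Z.quot z 4), (Z.rem y 2), (Z.rem z 4); split; lia.
Qed.

Lemma ball_even_second k x y z : ball k.+1 (x, 2 * y, z) -> exists x' z' dx dz,
  [/\ x = 2 * x' + dx, z = 4 * z' + dz + 2 * dx * y, - 2 < dx < 2, - 4 < dz < 4 &
      ball k (x', y, z')].
Proof.
rewrite /ball !pow_of_natS.
have := pow_of_nat_gt0 (b := 2) k; have := pow_of_nat_gt0 (b := 4) k.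
move=> p4_gt0 p2_gt0 bound; set dx := Z.rem x 2; set m := 2 * dx * y.
have m_bound : Z.abs m <= 2 * Z.abs y.
  have : dx = 0 \/ dx = 1 \/ dx = -1 by rewrite /dx; lia.
  by rewrite /m => -[->|[->|->]]; lia.
by exists (Z.quot x 2), (Z.quot (z - m) 4), dx, (Z.rem (z - m) 4); split; lia.
Qed.

Definition agree_ball (k : nat) (w : config tile) (g : H3) (w' : config tile) (g' : H3) : Prop :=
  forall h, ball k h -> w (h3_mul h g) = w' (h3_mul h g').

Section AgreementOfDesubstitutions.

Variables (w w' : config tile) (k : nat) (a b c a' b' c' : Z).
Hypotheses (nor : normalized w) (nor' : normalized w').
Hypothesis agr : agree_ball k (desub w) (a, b, c) (desub w') (a', b', c').

Lemma agree_desub_parity : a mod 2 = a' mod 2 /\ b mod 2 = b' mod 2.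
Proof.
have := agr (ball_one k); rewrite !h3_1mul => E.
have := congr1 (fun t => parity t.1) E; have := congr1 (fun t => parity t.2) E.
by rewrite /desub /set_parity; read_sides; lia.
Qed.

Lemma agree_first h : ball k.+1 h ->
  (w (h3_mul h (dilate (a, b, c)))).1 = (w' (h3_mul h (dilate (a', b', c')))).1.
Proof.
case: h => [[x y] z] in_ball; have [Ea Eb] := agree_desub_parity.
rewrite /dilate !h3_mulE.
have [odd_x|even_x] : x mod 2 = 1 \/ x = 2 * (x / 2) by lia.
  have [t ->] : exists t, b = b' + 2 * t by exists ((b - b') / 2); lia.
  by rewrite !odd_first ?odd_sideE //; [congr (_, _, (_, _), (_, _))| |]; lia.
rewrite even_x in in_ball *; move: (x / 2) in_ball => {even_x}x in_ball.
have [y' [z' [dy [dz [-> -> dy_bound dz_bound /agr]]]]] := ball_even_first in_ball.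
have posE u v t : (2 * x + 2 * u, 2 * y' + dy + 2 * v, 4 * z' + dz + 4 * t + 2 * x * (2 * v)) =
    (2 * (x + u), 2 * (y' + v) + dy, 4 * (z' + t + x * v) + dz) by congr (_, _, _); lia.
by rewrite !posE !refine_first // !h3_mulE => ->.
Qed.

Lemma agree_second h : ball k.+1 h ->
  (w (h3_mul h (dilate (a, b, c)))).2 = (w' (h3_mul h (dilate (a', b', c')))).2.
Proof.
case: h => [[x y] z] in_ball; have [Ea Eb] := agree_desub_parity.
rewrite /dilate !h3_mulE.
have [odd_y|even_y] : y mod 2 = 1 \/ y = 2 * (y / 2) by lia.
  have [t ->] : exists t, b = b' + 2 * t by exists ((b - b') / 2); lia.
  have [s ->] : exists s, a = a' + 2 * s by exists ((a - a') / 2); lia.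
  by rewrite !odd_second ?odd_sideE //; [congr (_, _, (_, _), (_, _))| |]; lia.
rewrite even_y in in_ball *; move: (y / 2) in_ball => {even_y}y in_ball.
have [x' [z' [dx [dz [-> -> dx_bound dz_bound /agr]]]]] := ball_even_second in_ball.
have posE u v t : (2 * x' + dx + 2 * u, 2 * y + 2 * v,
      4 * z' + dz + 2 * dx * y + 4 * t + (2 * x' + dx) * (2 * v)) =
    (2 * (x' + u) + dx, 2 * (y + v), 4 * (z' + t + x' * v) + dz + 2 * dx * (y + v)).
  by congr (_, _, _); lia.
by rewrite !posE !refine_second // !h3_mulE => ->.
Qed.

End AgreementOfDesubstitutions.

Lemma desub_agree_ball k w v w' v' : normalized w -> normalized w' ->
  agree_ball k (desub w) v (desub w') v' -> agree_ball k.+1 w (dilate v) w' (dilate v').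
Proof.
case: v v' => [[a b] c] [[a' b'] c'] nor nor' agr h in_ball.
rewrite [LHS]surjective_pairing [RHS]surjective_pairing; congr (_, _).
  exact: (agree_first nor nor' agr).
exact: (agree_second nor nor' agr).
Qed.

(* [t] is the tile at a point [v] of the [k]-fold desubstitution of [w], and [g] is
   the position of [v] in [w]. *)
Fixpoint vertex (k : nat) (w : config tile) (g : H3) (t : tile) : Prop :=
  match k with
  | O => w g = t
  | S k' => exists a v, [/\ normalized (shift a w),
      vertex k' (desub (shift a w)) v t & g = h3_mul (dilate v) a]
  end.

Lemma vertex_determines k w w' g g' t :
  vertex k w g t -> vertex k w' g' t -> agree_ball k w g w' g'.
Proof.
elim: k w w' g g' => [|k IH] w w' g g'.
  move=> /= wg w'g' [[x y] z] in_ball.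
  have -> : (x, y, z) = h3_one by move: in_ball; rewrite /ball /h3_one => ?; congr (_, _, _); lia.
  by rewrite !h3_1mul wg w'g'.
move=> [a [v [nor vert ->]]] [a' [v' [nor' vert' ->]]] h in_ball.
by rewrite !h3_mulA; apply: (desub_agree_ball nor nor' (IH _ _ _ _ vert vert') in_ball).
Qed.

Lemma vertex_occurs k w t : Omega w -> crossing 1 t.1 t.2 -> exists g, vertex k w g t.
Proof.
elim: k w => [|k IH] w Omega_w cr; first exact: tile_occurs.
have [a nor] := Omega_normalize Omega_w; have [v vert] := IH _ (desub_Omega nor) cr.
by exists (h3_mul (dilate v) a), a, v.
Qed.

Lemma vertex_lattice k w : Omega w -> exists g, forall x y z, exists t,
  crossing 1 t.1 t.2 /\
  vertex k w (h3_mul (2 ^ Z.of_nat k * x, 2 ^ Z.of_nat k * y, 4 ^ Z.of_nat k * z) g) t.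
Proof.
elim: k w => [|k IH] w Omega_w.
  by exists h3_one => x y z; eexists; split; last by []; case: Omega_w.
have [a nor] := Omega_normalize Omega_w; have [g lattice] := IH _ (desub_Omega nor).
exists (h3_mul (dilate g) a) => x y z; have [t [cr vert]] := lattice x y z.
exists t; split=> //; do 2 eexists; split; [exact: nor|exact: vert|].
by rewrite dilateM -h3_mulA /dilate !pow_of_natS; congr (h3_mul (_, _, _) _); lia.
Qed.

Lemma exists_near_multiple m c : 0 < m -> exists n, 2 * Z.abs (c - m * n) <= m.
Proof.
move=> m_gt0; exists ((2 * c + m) / (2 * m)).
have := Z.div_mod (2 * c + m) (2 * m) ltac:(lia).
by have := Z.mod_pos_bound (2 * c + m) (2 * m) ltac:(lia); lia.
Qed.

Lemma exists_large_pow2 n : exists k, n < 2 ^ Z.of_nat k.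
Proof.
have [k n_le] := exists_nat_ge n; exists k.
by have := Z.pow_gt_lin_r 2 (Z.of_nat k); lia.
Qed.

Lemma vertex_covers w n : Omega w -> 0 <= n -> exists k g t,
  [/\ vertex k w g t, crossing 1 t.1 t.2 &
   forall x y z, Z.abs x <= n -> Z.abs y <= n -> Z.abs z <= n ->
     ball k (h3_mul (x, y, z) (h3_inv g))].
Proof.
move=> Omega_w n_ge0; have [k large] := exists_large_pow2 (6 * n + 10).
have [[[a b] c] lattice] := vertex_lattice k Omega_w.
have p4E : 4 ^ Z.of_nat k = 2 ^ Z.of_nat k * 2 ^ Z.of_nat k by rewrite -Z.pow_mul_l.
rewrite p4E in lattice; set p := 2 ^ Z.of_nat k in p4E lattice large.
have pp : p * (6 * n + 10) < p * p by apply: (proj1 (Z.mul_lt_mono_pos_l p _ _ _)); lia.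
have [x0 near_x] := exists_near_multiple (m := p) (- a) ltac:(lia).
have [y0 near_y] := exists_near_multiple (m := p) (- b) ltac:(lia).
pose c0 := (p * x0 + a) * (p * y0 + b) - c - p * x0 * b.
have [z0 near_z] := exists_near_multiple (m := p * p) c0 ltac:(apply: Z.mul_pos_pos; lia).
have [t [cr vert]] := lattice x0 y0 z0.
exists k; eexists; exists t; split; [exact: vert|by []|] => x y z x_le y_le z_le.
have shear : Z.abs (x * (- b - p * y0)) <= n * p.
  by rewrite Z.abs_mul; apply: Z.mul_le_mono_nonneg; lia.
rewrite h3_mulE /h3_inv h3_mulE /ball -/p p4E.
have -> : z + ((p * x0 + a) * (p * y0 + b) - (p * p * z0 + c + p * x0 * b)) +
    x * - (p * y0 + b) = z + (c0 - p * p * z0) + x * (- b - p * y0) by rewrite /c0; lia.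
move: (c0 - p * p * z0) (x * (- b - p * y0)) near_z shear => u v near_z shear.
by repeat split; lia.
Qed.

Lemma exists_bound (F : list H3) : exists n, 0 <= n /\
  forall x y z, In (x, y, z) F -> Z.abs x <= n /\ Z.abs y <= n /\ Z.abs z <= n.
Proof.
elim: F => [|[[x y] z] F [n [n_ge0 bound]]]; first by exists 0.
exists (n + Z.abs x + Z.abs y + Z.abs z); split; first lia.
by move=> x' y' z' [[<- <- <-]|/bound]; lia.
Qed.

Lemma Omega_recurrent w w' F : Omega w -> Omega w' -> exists g, agree_on F w (shift g w').
Proof.
move=> Omega_w Omega_w'; have [n [n_ge0 bound]] := exists_bound F.
have [k [g [t [vert cr cover]]]] := vertex_covers Omega_w n_ge0.
have [g' vert'] := vertex_occurs k Omega_w' cr.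
exists (h3_mul (h3_inv g) g') => -[[x y] z] /bound [x_le [y_le z_le]].
have := vertex_determines vert vert' (cover x y z x_le y_le z_le).
by rewrite /shift -!h3_mulA h3_mulVl h3_mul1.
Qed.

Lemma Omega_minimal : minimal Omega.
Proof. by apply: recurrent_minimal => w w' F Omega_w Omega_w'; exact: Omega_recurrent. Qed.

(** * Existence of a configuration *)

Definition scale (p : plane) : plane :=
  {| plane_parity := bit_of 0;
     plane_digit := plane_digit p;
     plane_horiz y := at_offset (y mod 2) (plane_horiz p (y / 2));
     plane_central z := at_offset (z mod 4) (plane_central p (z / 4)) |}.

Fixpoint dyadic_pos (sign : positive -> Z) (n : positive) : plane :=
  if n is xO n' then scale (dyadic_pos sign n') else odd_plane (sign n).

Definition dyadic (p0 : plane) : family := fun x =>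
  match x with
  | Z0 => p0
  | Zpos n => dyadic_pos Zpos n
  | Zneg n => dyadic_pos Zneg n
  end.

Definition scale_invariant (p : plane) : Prop :=
  forall y z, side_at (scale p) y z = side_at p y z.

(* The planes [x = 0] and [y = 0] have infinite level; they look like planes
   [x = 2^l] and [y = 2^n] with [n] large and [l] much larger than [n]. *)
Definition zero_first : plane :=
  {| plane_parity := bit_of 0;
     plane_digit := bit_of 0;
     plane_horiz _ := (quarter_of 0, bit_of 0);
     plane_central _ := (quarter_of 0, bit_of 0) |}.

Definition zero_second : plane :=
  {| plane_parity := bit_of 0;
     plane_digit := bit_of 0;
     plane_horiz x := (quarter_of (if x <? 0 then -1 else 0), bit_of (if x =? 0 then 1 else 0));
     plane_central _ := (quarter_of 0, bit_of 0) |}.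

Lemma zero_first_invariant : scale_invariant zero_first.
Proof.
move=> y z; rewrite /scale /side_at /=.
by congr (_, _, _, _); apply: clock_eq; rewrite ?display_at_offset ?tick_at_offset //;
  try (case: Z.eqb => //); lia.
Qed.

Lemma zero_second_invariant : scale_invariant zero_second.
Proof.
move=> x z; rewrite /scale /side_at /=.
congr (_, _, _, _); apply: clock_eq; rewrite ?display_at_offset ?tick_at_offset //; try lia.
- by read_sides; do 2 case: Z.ltb_spec; lia.
- by read_sides; do ! case: Z.eqb_spec; lia.
- by case: Z.eqb.
Qed.

Lemma dyadic_odd p0 x : x mod 2 = 1 -> dyadic p0 x = odd_plane x.
Proof. by case: x => [|[n|n|]|[n|n|]] // ?; lia. Qed.

Lemma side_at_dyadic_double p0 x y z : scale_invariant p0 ->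
  side_at (dyadic p0 (2 * x)) y z =
  refine (y mod 2) (z mod 4) (side_at (dyadic p0 x) (y / 2) (z / 4)).
Proof. by move=> inv; case: x => [|n|n] //=; rewrite -inv. Qed.

Lemma dyadic_parity p0 x : scale_invariant p0 -> plane_parity (dyadic p0 x) = x mod 2 :> Z.
Proof.
move=> inv; have [odd_x|Ex] : x mod 2 = 1 \/ x = 2 * (x / 2) by lia.
  by rewrite dyadic_odd //=; lia.
have := congr1 parity (side_at_dyadic_double (x / 2) 0 0 inv).
by rewrite -Ex; read_sides; rewrite /refine; read_sides; lia.
Qed.

Lemma odd_plane_running x : running_plane (odd_plane x).
Proof. by split=> n; rewrite /advances; read_sides; lia. Qed.

Lemma scale_running p : running_plane p -> running_plane (scale p).
Proof.
case=> run_h run_c; split; first exact: (running_refine (m := 2) _ run_h).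
exact: (running_refine (m := 4) _ run_c).
Qed.

Lemma dyadic_running p0 x : running_plane p0 -> running_plane (dyadic p0 x).
Proof.
move=> run; case: x => //; elim=> [n _|n IH|];
  by [exact: odd_plane_running|exact: scale_running].
Qed.

Lemma dyadic_regular p0 : scale_invariant p0 -> running_plane p0 -> regular (dyadic p0).
Proof.
move=> inv run; split=> x; first exact: dyadic_running.
by rewrite !dyadic_parity //; lia.
Qed.

Lemma zero_first_running : running_plane zero_first.
Proof. by split=> n; rewrite /advances /zero_first; read_sides; lia. Qed.

Lemma zero_second_running : running_plane zero_second.
Proof.
split=> n; rewrite /advances /zero_second; read_sides; last by lia.
by do ! [case: Z.ltb_spec|case: Z.eqb_spec]; lia.
Qed.

Lemma odd_mul_mod4 x y : x mod 2 = 1 -> y mod 2 = 1 ->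
  (x * y) mod 4 = (1 + 2 * ((x / 2) mod 2) + 2 * ((y / 2) mod 2)) mod 4.
Proof.
move=> odd_x odd_y.
have [i xE] : exists i, x = 4 * i + (1 + 2 * ((x / 2) mod 2)) by exists (x / 4); lia.
have [j yE] : exists j, y = 4 * j + (1 + 2 * ((y / 2) mod 2)) by exists (y / 4); lia.
have [r|r] : (x / 2) mod 2 = 0 \/ (x / 2) mod 2 = 1 by lia.
all: have [r'|r'] : (y / 2) mod 2 = 0 \/ (y / 2) mod 2 = 1 by lia.
all: by rewrite r r' in xE yE *; rewrite xE yE; lia.
Qed.

Lemma odd_odd_crossing x y z : x mod 2 = 1 -> y mod 2 = 1 ->
  crossing 1 (odd_side x y z) (odd_side y x (z - x * y)).
Proof.
move=> odd_x odd_y; rewrite /crossing /odd_rule /compatible /level_rule; read_sides.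
split; [lia|split; [lia|left]]; do 5 (split; first lia).
by have := odd_mul_mod4 odd_x odd_y; lia.
Qed.

Lemma odd_dyadic_crossing e p0 x y z z' : scale_invariant p0 ->
  x mod 2 = 1 -> y mod 2 = 0 -> z' mod 4 = (z + y) mod 4 ->
  crossing e (odd_side x y z) (side_at (dyadic p0 y) x z').
Proof.
move=> inv odd_x even_y Ez; have Ey : y = 2 * (y / 2) by lia.
rewrite {2}Ey side_at_dyadic_double // odd_x.
have level1 : y mod 4 = 2 -> side_at (dyadic p0 (y / 2)) (x / 2) (z' / 4) =
    odd_side (y / 2) (x / 2) (z' / 4) by move=> ?; rewrite dyadic_odd //; lia.
move: level1; case: (side_at _ _ _) => [[[p r] [q f]] [k h]] level1.
rewrite refineE //; last by lia.
have -> : (1 =? 0) = false by [].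
rewrite /crossing /odd_rule /compatible /below_rule; read_sides.
split; [lia|split; [lia|right; left; do 2 (split; first lia)]].
have [y_mod4|y_mod4] : y mod 4 = 2 \/ y mod 4 = 0 by lia.
- by left; case: (level1 y_mod4) => ? ? ? ? ? ?; case: Z.eqb_spec; lia.
- by right; case: Z.eqb_spec; lia.
Qed.

Lemma compatible_refine e s t d : 0 <= d -> compatible e s t ->
  compatible e (refine 0 d s) (refine 0 d t).
Proof.
move: s t => [[[? ?] [? ?]] [? ?]] [[[? ?] [? ?]] [? ?]] d_ge0.
rewrite !refineE //; have -> : (0 =? 0) = true by [].
by rewrite /compatible /level_rule /below_rule; read_sides; case: (d =? 0) => //;
  case=> [|[|]] rule; [left|right; left|right; right]; move: rule; read_sides; lia.
Qed.

Lemma zero_crossing z z' : crossing 1 (side_at zero_first 0 z) (side_at zero_second 0 z').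
Proof.
rewrite /crossing /odd_rule /compatible /below_rule /zero_first /zero_second; read_sides.
have -> : (0 <? 0) = false by []; have -> : (0 =? 0) = true by [].
by split; [lia|split; [lia|right; right; lia]].
Qed.

Lemma dyadic_crossing x y z z' : z' = z - 1 * (x * y) ->
  crossing 1 (side_at (dyadic zero_first x) y z) (side_at (dyadic zero_second y) x z').
Proof.
have [n] := exists_nat_ge (Z.abs x + Z.abs y).
elim: n x y z z' => [|n IH] x y z z' bound Ez.
  have [-> ->] : x = 0 /\ y = 0 by lia.
  exact: zero_crossing.
have [odd_x|even_x] : x mod 2 = 1 \/ x mod 2 = 0 by lia.
all: have [odd_y|even_y] : y mod 2 = 1 \/ y mod 2 = 0 by lia.
- rewrite !dyadic_odd // Ez Z.mul_1_l; exact: odd_odd_crossing.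
- rewrite (dyadic_odd _ odd_x); apply: odd_dyadic_crossing => //; last by lia.
  exact: zero_second_invariant.
- rewrite (dyadic_odd _ odd_y); apply: (crossing_sym (e := -1)); first by right.
  by apply: odd_dyadic_crossing => //; [exact: zero_first_invariant|lia].
- have [Ex Ey] : x = 2 * (x / 2) /\ y = 2 * (y / 2) by lia.
  have [Ez4 z_mod4] : z' / 4 = z / 4 - 1 * (x / 2 * (y / 2)) /\ z' mod 4 = z mod 4.
    by rewrite Ez {1 3}Ex {1 3}Ey; move: (x / 2) (y / 2) => a b; split; lia.
  have [[x0 y0]|bound'] : (x = 0 /\ y = 0) \/ Z.abs (x / 2) + Z.abs (y / 2) <= Z.of_nat n by lia.
    by apply: IH Ez; lia.
  have [_ [_ rule]] := IH _ _ _ _ bound' Ez4.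
  rewrite Ex Ey !side_at_dyadic_double; [|exact: zero_second_invariant|exact: zero_first_invariant].
  rewrite -Ex -Ey even_x even_y z_mod4.
  split; [|split; [|by apply: compatible_refine rule; lia]];
    by rewrite /odd_rule /refine; read_sides; lia.
Qed.

Lemma dyadic_tiling : tiling 1 (dyadic zero_first) (dyadic zero_second).
Proof.
split; [by left| | |by move=> *; exact: dyadic_crossing].
- exact: dyadic_regular zero_first_invariant zero_first_running.
- exact: dyadic_regular zero_second_invariant zero_second_running.
Qed.

Lemma Omega_subshift : subshift Omega.
Proof.
split; last by split; [exact: SFT_closed Omega_SFT|exact: Omega_shift].
by exists (assemble (dyadic zero_first) (dyadic zero_second)); exact: assemble_Omega dyadic_tiling.
Qed.

Theorem theorem1 :
  exists (A B : finType) (Omega : cset A) (phi : config A -> config B),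
    is_SFT Omega /\ subshift Omega /\ strongly_aperiodic Omega /\
    factor_map_on phi Omega /\
    subshift (img_set phi Omega) /\
    strongly_aperiodic (img_set phi Omega) /\ minimal (img_set phi Omega) /\
    at_most_two_to_one phi Omega /\
    exists D : cset B, dense_in D (img_set phi Omega) /\
      forall y, D y -> unique_preimage phi Omega y.
Proof.
exists (tile : finType), (tile : finType), Omega, id; rewrite img_set_id.
split; first exact: Omega_SFT.
split; first exact: Omega_subshift.
split; first exact: Omega_strongly_aperiodic.
split; first by split=> // w F _; exists F.
split; first exact: Omega_subshift.
split; first exact: Omega_strongly_aperiodic.
split; first exact: Omega_minimal.
split; first by move=> y w1 w2 w3 _ _ _ /cfg_eqP -> /cfg_eqP ->; left.
exists Omega; split; first by split=> // w F Omega_w; exists w.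
by move=> y Omega_y; exists y.
Qed.
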